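(* The polynomial $R$ of twisted graph diagrams is invariant under the twisted move T3: if twisted graph diagrams $E$ and $E'$ differ by one such move, then $R(E)=R(E')$.
   Context: Graphs are finite, may be disconnected, may have loops and multiple edges, and may have circle components (components homeomorphic to a circle and without vertices). A twisted graph diagram is a diagram of a graph in $\mathbb{R}^2$ whose multiple points are transverse double points away from vertices, each being either a classical crossing (with over/under information) or a virtual crossing (no such information), with finitely many bars (short transverse marks) on edges or circle components. It is pure if it has no classical crossings. Surface of a pure diagram. For a pure twisted graph diagram $E$ without circle components let $S$ be the compact surface with a disk for each vertex and a band for each edge, the bands attached to the vertex disks in the cyclic order in which the edges leave the vertex in the plane, a band having a half twist for each bar on its edge (relative to the planar orientation of the disks); virtual crossings are ignored (bands pass each other without meeting). Let $k(S)$ be the number of connected components, $n(S)$ the first Betti number, $b(S)$ the number of boundary components, and $t(S)=0$ if $S$ is orientable, $t(S)=1$ otherwise. Put $M(\emptyset)=1$ and $$M(E)=(-1)^{k(S)}y^{n(S)}z^{k(S)-b(S)+n(S)}w^{t(S)}\in\mathbb{Z}[y,z,w]/(w^2-w).$$ For a pure twisted graph diagram $F$ let $o(F)$, resp. $e(F)$, be the number of circle components with an odd, resp. even (possibly zero), number of bars. Put $Q(\emptyset)=1$ and $$Q(F)(y,z,w)=(-1-y)^{e(F)}(-1-yzw)^{o(F)}\sum_{E\subset F}M(E),$$ the sum being over all subdiagrams $E$ given by spanning subgraphs (all vertices, any subset of edges) of $F$ with its circle components removed. States. At a classical crossing whose over-strand joins the ends SW and NE and whose under-strand joins NW and SE: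 spin $+1$ replaces it by two disjoint arcs joining SW to NW and SE to NE; spin $-1$ by two disjoint arcs joining SW to SE and NW to NE; spin $0$ by a vertex of degree 4. A state $S$ of a twisted graph diagram $E$ is the pure twisted graph diagram obtained by choosing a spin at every classical crossing; $\mathcal{S}(E)$ is the set of states, and $\{E\mid S\}:=a^{p-q}$ where $p,q$ are the numbers of crossings with spin $+1$, $-1$. Define $$R(E)(a,z,w)=\sum_{S\in\mathcal{S}(E)}\{E\mid S\}\,Q(S)(-a-2-a^{-1},z,w)\in\mathbb{Z}[a^{\pm1},z,w]/(w^2-w).$$ Move T3 (inside a disk, diagram unchanged outside): a classical crossing with ends NW, NE, SW, SE and over-strand joining SW to NE is replaced by a horizontal row consisting of a virtual crossing of the two left strands, a classical crossing whose local picture is again ''over-strand of positive slope'' (joining its local SW to its local NE), and a virtual crossing of the two right strands, together with one bar on each of the four ends. (So in the new diagram the over-strand joins the outer ends NW and SE.) *)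

(* Defs.v *)
From HB Require Import structures.
From mathcomp Require Import all_boot all_order all_algebra.
From mathcomp Require Import generic_quotient ring_quotient boolp mpoly.

Set Implicit Arguments.
Unset Strict Implicit.
Unset Printing Implicit Defensive.

Import GRing.Theory.

(* A diagram is encoded by its planar map.  The points of the plane at which
   something happens (vertices, crossings, bars) are the nodes of the map, and
   the pieces of curve between consecutive nodes are its arcs.  A joint is an
   ordinary point of a curve which is used as a node: it may subdivide an arc,
   and it makes a circle with nothing on it into an arc from the joint to
   itself. *)

(* The kind of a dart (an end of an arc, pointing away from a node) gives the
   type of its node and, at a classical crossing, whether the dart lies on the
   over-strand or on the under-strand. *)
Inductive dart_kind := Vertex | Over | Under | Virtual | Bar | Joint.

Definition nat_of_kind (k : dart_kind) : nat :=
  match k with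
  | Vertex => 0 | Over => 1 | Under => 2 | Virtual => 3 | Bar => 4 | Joint => 5
  end.
Definition kind_of_nat (n : nat) : dart_kind :=
  match n with
  | 0 => Vertex | 1 => Over | 2 => Under | 3 => Virtual | 4 => Bar | _ => Joint
  end.
Lemma nat_of_kindK : cancel nat_of_kind kind_of_nat. Proof. by case. Qed.
HB.instance Definition _ := Equality.copy dart_kind (can_type nat_of_kindK).

Definition quarter_turn (k : dart_kind) : dart_kind :=
  match k with Over => Under | Under => Over | _ => k end.

Definition degree_ok (k : dart_kind) (deg : nat) : bool :=
  match k with
  | Vertex => true
  | Over | Under | Virtual => deg == 4
  | Bar | Joint => deg == 2
  end.

(* [turn x] is the next dart after [x], counterclockwise, around the node of
   [x], so the nodes are the orbits of [turn]; [flip x] is the other end of the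
   arc of [x].  Vertices of degree 0 carry no dart and are counted apart. *)
Record diagram := Diagram {
  dart : finType;
  turn : dart -> dart;
  flip : dart -> dart;
  kind : dart -> dart_kind;
  isolated : nat;
  turn_inj : injective turn;
  flipK : involutive flip;
  flip_neq : forall x, flip x != x;
  kind_turn : forall x, kind (turn x) = quarter_turn (kind x);
  kind_degree : forall x, degree_ok (kind x) (order turn x)
}.

Arguments turn {d} x.
Arguments flip {d} x.
Arguments kind {d} x.

(* Euler's formula #nodes - #arcs + #faces = 2 * #components for the map,
   with 2 * #arcs = #darts. *)
Definition planar (E : diagram) : Prop :=
  fcard (@turn E) (dart E) + fcard (@flip E) (dart E)
    + fcard (fun x : dart E => turn (flip x)) (dart E)
  = #|dart E| + 2 * n_comp [rel x y : dart E | (y == turn x) || (y == flip x)]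
                         (dart E).

Definition is_vertex (E : diagram) (x : dart E) : bool := kind x == Vertex.
Definition is_classical (E : diagram) (x : dart E) : bool :=
  (kind x == Over) || (kind x == Under).

Definition pure (F : diagram) : Prop := forall x : dart F, ~~ is_classical x.

Section PureDiagrams.

Variable F : diagram.
Implicit Types (x y : dart F) (A : {set {set dart F}}).

(* Going straight through the node of [x], which is not a vertex. *)
Definition across x : dart F :=
  match kind x with
  | Vertex => x
  | Over | Under | Virtual => turn (turn x)
  | Bar | Joint => turn x
  end.

Definition along : rel (dart F) :=
  [rel x y | (y == flip x) || ~~ is_vertex x && (y == across x)].

(* The edges and the circle components of the diagram, each one as the set of
   the darts on it. *)
Definition strand x : {set dart F} := [set y | connect along x y].
Definition strands : {set {set dart F}} := [set strand x | x : dart F].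
Definition edges : {set {set dart F}} :=
  [set X in strands | [exists x in X, is_vertex x]].
Definition circles : {set {set dart F}} := strands :\: edges.

(* A bar is a node with two darts, both on the same strand. *)
Definition bars (X : {set dart F}) : nat := #|[set x in X | kind x == Bar]|./2.

(* In the rest of the section [A] is a set of edges, and stands for the
   spanning subdiagram of [F] whose edges are those in [A].  An edge has exactly
   two darts at vertices, the places where its band is attached. *)
Definition band A : rel (dart F) :=
  [rel x y | [&& is_vertex x, is_vertex y, x != y, strand x \in A
               & y \in strand x]].

Definition half_twisted x : bool := odd (bars (strand x)).

Definition num_vertices : nat := fcard (@turn F) (@is_vertex F) + isolated F.

Definition surf_comp A : nat :=
  n_comp [rel x y : dart F | [|| y == turn x, x == turn y | band A x y]]
         (@is_vertex F) + isolated F.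

(* The surface retracts to the graph with edge set [A], whose Euler
   characteristic is the number of components minus the first Betti number. *)
Definition surf_betti A : nat := #|A| + surf_comp A - num_vertices.

(* The point [(x, true)] (resp. [(x, false)]) lies on the boundary of the
   vertex disk, just after (resp. before) [x] counterclockwise.  Between
   consecutive darts the boundary of the surface follows that of the disk;
   where the band of an edge of [A] is attached, it follows the side of the
   band, and a band with no half twist joins the left side at one end, looking
   away from the vertex, to the right side at the other end.  If the edge is not
   in [A] it just follows the boundary of the disk. *)
Definition boundary_step A : rel (dart F * bool) :=
  [rel p q |
    [|| [&& p.2, ~~ q.2 & q.1 == turn p.1],
        band A p.1 q.1 && (q.2 == (if half_twisted p.1 then p.2 else ~~ p.2))
      | [&& strand p.1 \notin A, q.1 == p.1 & q.2 != p.2]]].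

Definition surf_boundary A : nat :=
  n_comp [rel p q | boundary_step A p q || boundary_step A q p]
         [pred p : dart F * bool | is_vertex p.1] + isolated F.

(* Orientations of the vertex disks, [true] for that of the plane, which extend
   over the bands. *)
Definition surf_orientable A : bool :=
  [exists o : {ffun dart F -> bool},
    [forall x, is_vertex x ==> (o (turn x) == o x)] &&
    [forall x, forall y, band A x y ==> (o x (+) o y == half_twisted x)]].

Definition surf_t A : nat := ~~ surf_orientable A.

Section Polynomials.

Local Open Scope ring_scope.
Variables (K : comNzRingType) (y z w : K).

(* [k - b + n] is never negative, so the truncated subtraction is exact. *)
Definition M A : K :=
  (-1) ^+ surf_comp A * y ^+ surf_betti A
  * z ^+ (surf_comp A + surf_betti A - surf_boundary A)
  * w ^+ surf_t A.

Definition even_circles : nat := #|[set X in circles | ~~ odd (bars X)]|.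
Definition odd_circles : nat := #|[set X in circles | odd (bars X)]|.

Definition Q : K :=
  (-1 - y) ^+ even_circles * (-1 - y * z * w) ^+ odd_circles
  * \sum_(A : {set {set dart F}} | A \subset edges) M A.

End Polynomials.

End PureDiagrams.

Inductive spin := Plus | Minus | Zero.

Definition opt_of_spin (s : spin) : option bool :=
  match s with Plus => Some true | Minus => Some false | Zero => None end.
Definition spin_of_opt (o : option bool) : spin :=
  match o with Some true => Plus | Some false => Minus | None => Zero end.
Lemma opt_of_spinK : cancel opt_of_spin spin_of_opt. Proof. by case. Qed.
HB.instance Definition _ := Finite.copy spin (can_type opt_of_spinK).

Section States.

Variable E : diagram.
Implicit Type x : dart E.

Definition node_of x : {set dart E} := [set y | fconnect turn x y].
Definition crossings : {set {set dart E}} :=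
  [set node_of x | x in @is_classical E].
Definition crossing := {c : {set dart E} | c \in crossings}.
Definition state := {ffun crossing -> spin}.

Variable s : state.

(* [None] if [x] is not at a classical crossing. *)
Definition spin_at x : option spin := omap s (insub (node_of x)).

(* If the over-strand joins SW to NE, the over-dart NE is followed
   counterclockwise by NW and preceded by SE, and the over-dart SW is followed
   by SE and preceded by NW. *)
Definition state_turn x : dart E :=
  match spin_at x with
  | Some Plus => if kind x == Over then finv turn x else turn x
  | Some Minus => if kind x == Over then turn x else finv turn x
  | Some Zero | None => turn x
  end.

Definition state_kind x : dart_kind :=
  match spin_at x with
  | Some Plus | Some Minus => Joint
  | Some Zero => Vertex
  | None => kind x
  end.

Lemma node_of_connect x y : fconnect turn x y -> node_of x = node_of y.
Proof.
move=> cxy; apply/setP=> t; rewrite !inE.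
exact: (same_connect (fconnect_sym (@turn_inj E)) cxy).
Qed.

Lemma spin_at_connect x y : fconnect turn x y -> spin_at x = spin_at y.
Proof. by move=> cxy; rewrite /spin_at (node_of_connect cxy). Qed.

Lemma spin_at_turn x : spin_at (turn x) = spin_at x.
Proof. by rewrite -(spin_at_connect (fconnect1 _ x)). Qed.

Lemma spin_at_finv x : spin_at (finv turn x) = spin_at x.
Proof. by rewrite -{2}(f_finv (@turn_inj E) x) spin_at_turn. Qed.

Lemma is_classical_turn x : is_classical (turn x) = is_classical x.
Proof. by rewrite /is_classical kind_turn; case: (kind x). Qed.

Lemma is_classical_spin x : spin_at x <> None -> is_classical x.
Proof.
rewrite /spin_at; case: insubP => //= c /imsetP[u cu eqn] _ _.
have: x \in node_of u by rewrite -eqn inE connect0.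
rewrite inE => /iter_findex <-.
by elim: (findex _ _ _) => //= n; rewrite is_classical_turn.
Qed.

Lemma kind_finv x : is_classical x -> kind (finv turn x) = quarter_turn (kind x).
Proof.
rewrite -{1 3}(f_finv (@turn_inj E) x) is_classical_turn kind_turn /is_classical.
by case: (kind (finv turn x)).
Qed.

Lemma classical_neq x y :
  is_classical x -> kind y = quarter_turn (kind x) -> y != x.
Proof.
move=> cx ky; apply/eqP=> eyx; move: cx ky.
by rewrite eyx /is_classical; case: (kind x).
Qed.

Lemma state_turnK x :
  spin_at x <> None -> spin_at x <> Some Zero ->
  state_turn (state_turn x) = x /\ state_turn x != x.
Proof.
move=> s0; have cx := is_classical_spin s0; move: s0; rewrite /state_turn.
have [kt kf] := (kind_turn x, kind_finv cx).
have n1 := classical_neq cx kt; have n2 := classical_neq cx kf.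
case sx: (spin_at x) => [[]|] // _ _; case/orP: cx kt kf => /eqP kx;
  rewrite kx /= ?spin_at_turn ?spin_at_finv sx => kt kf; rewrite ?kt ?kf /=;
  by rewrite ?(f_finv (@turn_inj E)) ?(finv_f (@turn_inj E)).
Qed.

Lemma spin_at_state x : spin_at (state_turn x) = spin_at x.
Proof.
rewrite /state_turn; case: (spin_at x) (spin_at_turn x) (spin_at_finv x) => [[]|] //=;
by case: ifP.
Qed.

Lemma state_turn_inj : injective state_turn.
Proof.
move=> x y eqxy; have := spin_at_state x; rewrite eqxy spin_at_state => sxy.
have invol o : spin_at x = Some o -> o <> Zero -> x = y.
  move=> sx o0; have [<- _] : state_turn (state_turn x) = x /\ state_turn x != x.
    by apply: state_turnK; rewrite sx // => -[].
  by rewrite eqxy; case: (@state_turnK y); rewrite ?sxy ?sx // => -[].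
case sx: (spin_at x) sxy => [[]|] sxy; try by apply: (invol _ sx).
- by apply: (@turn_inj E); move: eqxy; rewrite /state_turn sxy sx.
- by apply: (@turn_inj E); move: eqxy; rewrite /state_turn sxy sx.
Qed.

Lemma state_kind_turn x :
  state_kind (state_turn x) = quarter_turn (state_kind x).
Proof.
rewrite /state_kind spin_at_state /state_turn.
by case: (spin_at x) => [[]|] //; rewrite kind_turn.
Qed.

Lemma state_order x : spin_at x = None -> order state_turn x = order turn x.
Proof.
move=> sx; rewrite -[RHS](size_orbit turn x); apply: (order_cycle (p := orbit turn x)).
- rewrite (@eq_in_cycle _ (mem (orbit turn x)) _ (frel turn)).
  + exact: (cycle_orbit (@turn_inj E)).
  + move=> u v uo _ /=; rewrite /state_turn -(@spin_at_connect x u) ?sx //.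
    by rewrite fconnect_orbit.
  + by apply/allP => u.
- exact: orbit_uniq.
- exact: in_orbit.
Qed.

Lemma state_degree x : degree_ok (state_kind x) (order state_turn x).
Proof.
have main: spin_at x <> None -> spin_at x <> Some Zero -> order state_turn x == 2.
  move=> s1 s2; have [K n] := state_turnK s1 s2; apply/eqP.
  apply: (order_cycle (p := [:: x; state_turn x])); rewrite /= ?inE ?eqxx //.
  - by rewrite K eqxx.
  - by rewrite eq_sym n.
rewrite /state_kind; case sx: (spin_at x) main => [[]|] main //=; try exact: main.
by rewrite state_order //; apply: kind_degree.
Qed.

Definition state_diagram : diagram :=
  Diagram (isolated E) state_turn_inj (@flipK E) (@flip_neq E)
          state_kind_turn state_degree.

Lemma pure_state_diagram : pure state_diagram.
Proof.
move=> x; rewrite /is_classical /= /state_kind.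
case sx: (spin_at x) => [[]|] //; apply/negP=> cx.
move: sx; rewrite /spin_at; case: insubP => //=.
by rewrite (imset_f node_of (cx : x \in @is_classical E)).
Qed.

Definition num_plus : nat := #|[set c | s c == Plus]|.
Definition num_minus : nat := #|[set c | s c == Minus]|.

End States.

Section StateSum.

Local Open Scope ring_scope.

(* The state sum in a commutative ring, at elements [a], [a'] with
   [a * a' = 1], [z] and [w]. *)
Definition state_sum (K : comNzRingType) (a a' z w : K) (E : diagram) : K :=
  \sum_(s : state E)
    a ^+ num_plus s * a' ^+ num_minus s
    * Q (state_diagram s) (- a - 2%:R - a') z w.

(* Z[a, 1/a, z, w] / (w^2 - w) as the quotient of Z[a, a', z, w] by the ideal
   generated by a a' - 1 and w^2 - w. *)
Notation P4 := {mpoly int[4]}.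
Definition Xa : P4 := 'X_(inord 0).
Definition Xa' : P4 := 'X_(inord 1).
Definition Xz : P4 := 'X_(inord 2).
Definition Xw : P4 := 'X_(inord 3).

Definition coef_ideal : pred P4 :=
  fun p => `[< exists u v : P4,
                 p = u * (Xa * Xa' - 1) + v * (Xw ^+ 2 - Xw) >].

Lemma coef_ideal_closed : idealr_closed coef_ideal.
Proof.
split.
- by apply/asboolP; exists 0, 0; rewrite !mul0r addr0.
- apply/asboolPn=> -[u [v]] /(congr1 (mmap (@idfun int) (fun _ => 1))).
  rewrite rmorph1 rmorphD !rmorphM !rmorphB !rmorphXn rmorph1 rmorphM /=.
  by rewrite !mmapX !mmap1U ?expr1n !mulr1 !subrr !mulr0 addr0 => /eqP.
- move=> c p q /asboolP[u [v ->]] /asboolP[u' [v' ->]]; apply/asboolP.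
  exists (c * u + u'), (c * v + v').
  by rewrite mulrDr !mulrDl !mulrA addrACA.
Qed.

HB.instance Definition _ := isIdealr.Build P4 coef_ideal coef_ideal_closed.

Definition coef_ring : comNzRingType := {ideal_quot (coef_ideal : idealr P4)}.

Definition coef_class (p : P4) : coef_ring := \pi_{ideal_quot (coef_ideal : idealr P4)}%qT p.

Definition R (E : diagram) : coef_ring :=
  state_sum (coef_class Xa) (coef_class Xa') (coef_class Xz) (coef_class Xw) E.

End StateSum.

(* The ends of a crossing in counterclockwise order. *)
Inductive corner := NE | NW | SW | SE.

Definition next_corner (c : corner) : corner :=
  match c with NE => NW | NW => SW | SW => SE | SE => NE end.

(* The end [c] of the crossing which has [x] as its end NE. *)
Definition corner_dart (E : diagram) (x : dart E) (c : corner) : dart E :=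
  match c with
  | NE => x
  | NW => turn x
  | SW => turn (turn x)
  | SE => turn (turn (turn x))
  end.

(* What the move T3 introduces, with four darts each: the inner darts of the
   four bars, the left virtual crossing, the classical crossing and the right
   virtual crossing. *)
Inductive piece := Bars | LeftVirtual | Crossing | RightVirtual.

Definition piece_kind (p : piece) (c : corner) : dart_kind :=
  match p, c with
  | Bars, _ => Bar
  | Crossing, (NE | SW) => Over
  | Crossing, (NW | SE) => Under
  | (LeftVirtual | RightVirtual), _ => Virtual
  end.

Definition piece_flip (p : piece) (c : corner) : piece * corner :=
  match p, c with
  | Bars, NW => (LeftVirtual, NW)
  | Bars, SW => (LeftVirtual, SW)
  | Bars, NE => (RightVirtual, NE)
  | Bars, SE => (RightVirtual, SE)
  | LeftVirtual, NW => (Bars, NW)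
  | LeftVirtual, SW => (Bars, SW)
  | LeftVirtual, NE => (Crossing, NW)
  | LeftVirtual, SE => (Crossing, SW)
  | Crossing, NW => (LeftVirtual, NE)
  | Crossing, SW => (LeftVirtual, SE)
  | Crossing, NE => (RightVirtual, NW)
  | Crossing, SE => (RightVirtual, SW)
  | RightVirtual, NW => (Crossing, NE)
  | RightVirtual, SW => (Crossing, SE)
  | RightVirtual, NE => (Bars, NE)
  | RightVirtual, SE => (Bars, SE)
  end.

(* [E'] is obtained from [E] by the move T3 at the classical crossing with over
   strand from SW to NE whose end NE is the dart [x].  The darts of [E'] are, up
   to the bijection [phi], those of [E] and the new ones; the ends of the old
   crossing become the outer darts of the four bars. *)
Definition T3_at (E E' : diagram) (x : dart E)
    (phi : dart E + piece * corner -> dart E') : Prop :=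
  let old u := phi (inl u) in
  let new p c := phi (inr (p, c)) in
  [/\ kind x = Over, bijective phi & isolated E' = isolated E] /\
  [/\ forall u, flip (old u) = old (flip u),
      forall u, ~~ fconnect turn x u ->
        turn (old u) = old (turn u) /\ kind (old u) = kind u,
      forall c, [/\ turn (old (corner_dart x c)) = new Bars c,
                    turn (new Bars c) = old (corner_dart x c)
                  & kind (old (corner_dart x c)) = Bar],
      forall p c, p <> Bars -> turn (new p c) = new p (next_corner c)
    & forall p c, kind (new p c) = piece_kind p c
               /\ flip (new p c) = phi (inr (piece_flip p c))].

Definition T3 (E E' : diagram) : Prop :=
  exists (x : dart E) (phi : dart E + piece * corner -> dart E'),
    T3_at x phi.

(* Main.v *)
(* The states of the two diagrams correspond, the spin of each crossing being
   kept, and corresponding states have the same weight and the same value of [Q].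
   With a spin 1 or -1 at the crossing of the move, the states differ only by an
   even number of bars on each strand.  With spin 0, the new vertex carries its
   four edges in the reverse cyclic order, and each of its ends has one more bar:
   turning its disk over, which adds a half twist at each of these ends, identifies
   the surfaces of all spanning subdiagrams. *)

From mathcomp Require Import all_boot all_algebra.
Require Import Defs.

Set Implicit Arguments.
Unset Strict Implicit.
Unset Printing Implicit Defensive.

(** * Strands, bands and the vertex disks they join *)

Section Strands.

Variable F : diagram.
Implicit Types (x y z : dart F).

Lemma is_vertex_turn x : is_vertex (turn x) = is_vertex x.
Proof. by rewrite /is_vertex kind_turn; case: (kind x). Qed.

Lemma is_vertex_finv x : is_vertex (finv turn x) = is_vertex x.
Proof. by rewrite -is_vertex_turn (f_finv (@turn_inj F)). Qed.

Lemma kind_across x : kind (across x) = kind x.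
Proof. by rewrite /across; case kx: (kind x); rewrite ?kind_turn kx. Qed.

(** The orbit of [turn] has four darts at a crossing and two at a bar or a joint, so going straight
    through the node twice closes it up. *)
Lemma acrossK : involutive (@across F).
Proof.
move=> x; rewrite {1}/across kind_across.
have := kind_degree x; have := iter_order (@turn_inj F) x.
by rewrite /across; case: (kind x) => //= iter_x /eqP ord_x; rewrite ord_x in iter_x.
Qed.

Lemma across_vertex x : is_vertex x -> across x = x.
Proof. by rewrite /is_vertex /across => /eqP->. Qed.

Lemma along_sym : symmetric (@along F).
Proof.
move=> x y; apply/orP/orP=> -[/eqP->|/andP[vx /eqP->]].
- by left; rewrite flipK.
- by right; rewrite acrossK /is_vertex kind_across vx /=.
- by left; rewrite flipK.
- by right; rewrite acrossK /is_vertex kind_across vx /=.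
Qed.

Lemma connect_along_sym : connect_sym (@along F).
Proof. exact/sym_connect_sym/along_sym. Qed.

Lemma along_flip x : along x (flip x).
Proof. by rewrite /along /= eqxx. Qed.

Lemma connect_across x : connect (@along F) x (across x).
Proof.
have [vx|vx] := boolP (is_vertex x); first by rewrite across_vertex.
by rewrite connect1 // /along /= vx eqxx orbT.
Qed.

Lemma strand_refl x : x \in strand x.
Proof. by rewrite inE connect0. Qed.

Lemma strand_connect x y : connect (@along F) x y -> strand x = strand y.
Proof.
move=> cxy; apply/setP=> z; rewrite !inE.
exact: (same_connect connect_along_sym cxy).
Qed.

Lemma eq_strand x y : (strand x == strand y) = (y \in strand x).
Proof.
apply/eqP/idP => [->|]; first exact: strand_refl.
by rewrite inE => /strand_connect.
Qed.

Lemma strand_sym x y : (y \in strand x) = (x \in strand y).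
Proof. by rewrite !inE connect_along_sym. Qed.

Lemma strand_across x : strand (across x) = strand x.
Proof. by apply/esym/strand_connect/connect_across. Qed.

Lemma strand_flip x : strand (flip x) = strand x.
Proof. by apply/esym/strand_connect/connect1/along_flip. Qed.

(* From a dart [x] at a vertex the strand is the orbit of [x] under
   [across \o flip], which [across] reverses; a second dart fixed by [across]
   can therefore only be half way round the orbit. *)
Lemma strand_vertexP x y z :
  is_vertex x -> is_vertex y -> is_vertex z ->
  y \in strand x -> z \in strand x -> y != x -> z != x -> y = z.
Proof.
move=> vx vy vz; pose f u := across (flip u) : dart F.
have fI : injective f by apply: inj_comp (inv_inj acrossK) (inv_inj (@flipK F)).
have rev k : iter k f (across (iter k f x)) = x.
  elim: k => [|k IHk]; first exact: across_vertex.
  by rewrite iterSr iterS {1}/f /f acrossK flipK.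
have orb u : u \in strand x -> fconnect f x u.
  (* By [rev], iterating [f] leads from [across w] back to [x]; orbits are symmetric, so [across w]
     lies on the orbit of [x]. *)
  have a_orb v : fconnect f x v -> fconnect f x (across v).
    move=> /iter_findex <-; set w := iter _ f x.
    by have := fconnect_iter f (findex f x v) (across w); rewrite rev fconnect_sym.
  (* Since [flip v] is [across (f v)], stability of the orbit under [across] covers both kinds of
     step of [along]. *)
  have cl : closed (@along F) [pred v | fconnect f x v].
    apply: intro_closed connect_along_sym _ _ => v t /= + xv; rewrite inE in xv *.
    case/orP=> [/eqP->|/andP[_ /eqP->]]; last exact: a_orb.
    by rewrite inE -[flip v]acrossK a_orb // -/(f v) -same_fconnect1_r.
  by rewrite inE => /(closed_connect cl); rewrite !inE connect0.
have half u : is_vertex u -> u \in strand x -> u != x ->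
    (findex f x u).*2 = order f x.
  move=> vu /orb xu nux; have kn := findex_max xu.
  have k0 : findex f x u != 0 by rewrite findex_eq0 eq_sym.
  (* The dart [u] is the iterate of index [k] and is fixed by [across], so [rev] says that [k]
     further steps lead back to [x]. *)
  have fk : iter (findex f x u).*2 f x = x.
    have := rev (findex f x u); rewrite (iter_findex xu) across_vertex //.
    by rewrite -addnn iterD (iter_findex xu).
  set k := findex f x u in k0 kn fk *.
  (* Here [0 < k < order f x], and [k.*2] is a multiple of the order below twice the order: a
     smaller value would force [k = 0], and beyond the order the excess [m] has to be zero. *)
  have [lt|] := ltnP k.*2 (order f x).
    by have := findex_iter lt; rewrite fk findex0 => k2; rewrite -double_eq0 -k2 in k0.
  rewrite leq_eqVlt => /predU1P[//|lt]; have [m mE] : exists m, k.*2 = m + order f x.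
    by exists (k.*2 - order f x); rewrite subnK // ltnW.
  have ltm : m < order f x.
    by rewrite -(ltn_add2r (order f x)) -mE -addnn (leq_trans (n := k + order f x)) //
      ?ltn_add2l // leq_add2r ltnW.
  move: fk; rewrite mE iterD iter_order // => fm.
  by have := findex_iter ltm; rewrite fm findex0 => <-.
move=> xy xz ny nz; rewrite -(iter_findex (orb _ xy)) -(iter_findex (orb _ xz)).
by congr iter; apply: double_inj; rewrite !half.
Qed.

Lemma band_sym (A : {set {set dart F}}) : symmetric (band A).
Proof.
move=> x y; rewrite /band /= eq_sym strand_sym.
have [|] := boolP (x \in strand y); last by rewrite !andbF.
by rewrite -eq_strand => /eqP ->; rewrite !andbT andbCA.
Qed.


(** The relation whose components [surf_comp] counts. It contains [turn] in both directions, so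
    reversing the cyclic order at a vertex leaves it unchanged. *)
Definition surf_rel (B : {set {set dart F}}) : rel (dart F) :=
  [rel x y | [|| y == turn x, x == turn y | band B x y]].

Lemma surf_rel_sym (B : {set {set dart F}}) : symmetric (surf_rel B).
Proof. by move=> x y; rewrite /surf_rel /= band_sym orbCA. Qed.

(** With no bands, the components are the single vertex disks. The invariance of [num_vertices] thus
    becomes a case of that of the component count. *)
Lemma fcard_turn :
  fcard (@turn F) (@is_vertex F) = n_comp (surf_rel set0) (@is_vertex F).
Proof.
apply: eq_n_comp => x y; apply/idP/idP; apply: connect_sub => {x y} x y /=.
  by move=> /eqP <-; rewrite connect1 // /surf_rel /= eqxx.
rewrite /surf_rel /band /= in_set0 !andbF orbF => /orP[]/eqP->; last first.
  by rewrite fconnect_sym ?fconnect1 //; apply: turn_inj.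
exact: fconnect1.
Qed.

End Strands.

(** * Transport of component counts and of strands along maps *)

(** The part [a] is closed under [e] and covered by [h], so [h] restricts to an isomorphism of
    graphs onto it. This serves to count the components of a surface on the darts at vertices only,
    whatever nodes subdivide the strands. *)
Lemma n_comp_inj (T T' : finType) (h : T' -> T) (e : rel T) (e' : rel T')
    (a : pred T) (a' : pred T') :
  symmetric e -> symmetric e' -> injective h ->
  (forall x y, e x y -> a x -> a y) -> (forall x, a x -> x \in codom h) ->
  (forall x', a (h x') = a' x') ->
  (forall x' y', a' x' -> e (h x') (h y') = e' x' y') ->
  n_comp e a = n_comp e' a'.
Proof.
move=> se se' hI cl cod aE eE; have cs := sym_connect_sym se.
have cl_a : closed e a by apply: intro_closed cs _ _ => x y /cl.
rewrite (adjunction_n_comp h cs (sym_connect_sym se') cl_a).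
  by apply: eq_n_comp_r => x; rewrite !unfold_in -aE.
apply: (strict_adjunction (sym_connect_sym se') cl_a hI); first exact/subsetP.
by move=> x y; rewrite /= negbK => ahx; apply: eE; rewrite -aE.
Qed.

Lemma strand_transfer (G G' : diagram) (h : dart G -> dart G') :
  (forall x y, along x y -> h y \in strand (h x)) ->
  forall x y, y \in strand x -> h y \in strand (h x).
Proof.
move=> along_h x y; rewrite inE => /connectP[p + ->]; elim: p x => [|z p IHp] x /=.
  by rewrite strand_refl.
by case/andP=> /along_h + /IHp; rewrite -eq_strand => /eqP->.
Qed.

(* [F'] has, up to the subdivision of its strands, the same vertices and strands
   as [F]: the dart [x] of [F] lies where the dart [i x] of [F'] does, and [r u]
   is a dart of [F] on the strand of [u].  The set [d] is the union of the vertex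
   disks that are turned over, so that each end of a band at such a disk adds a
   half twist to the band. *)
Section TurningDisks.

Variables (F F' : diagram) (i : dart F -> dart F') (r : dart F' -> dart F).
Variable d : pred (dart F).

Implicit Types (x y : dart F) (u v : dart F').

Hypothesis rK : cancel i r.
Hypothesis strand_ir : forall u, i (r u) \in strand u.
Hypothesis along_r : forall u v, along u v -> r v \in strand (r u).
Hypothesis along_i : forall x y, along x y -> i y \in strand (i x).
Hypothesis vertex_i : forall x, is_vertex (i x) = is_vertex x.
Hypothesis vertex_ir : forall u, is_vertex u -> i (r u) = u.
Hypothesis d_turn : forall x, d (turn x) = d x.
Hypothesis turn_i : forall x, is_vertex x ->
  turn (i x) = i (if d x then finv turn x else turn x).
Hypothesis odd_bars : forall u,
  odd (bars (strand u)) = odd (bars (strand (r u)))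
    (+) odd #|[set x in strand (r u) | is_vertex x && d x]|.
Hypothesis isolatedE : isolated F' = isolated F.

Let iI : injective i := can_inj rK.

Lemma d_finv x : d (finv turn x) = d x.
Proof. by rewrite -d_turn (f_finv (@turn_inj F)). Qed.

Lemma strand_i x y : (i y \in strand (i x)) = (y \in strand x).
Proof.
apply/idP/idP; last exact: strand_transfer.
by move/(strand_transfer along_r); rewrite !rK.
Qed.

(** The map [r] preserves strands; conversely a strand followed in [F] is carried to [F'] by [i],
    and [i (r u)] has not left the strand of [u]. With [strand_i] this puts the strands of the two
    diagrams in bijection. *)
Lemma strand_r u v : (r v \in strand (r u)) = (v \in strand u).
Proof.
have eq_ir t : strand (i (r t)) = strand t.
  by apply/eqP; rewrite eq_sym eq_strand strand_ir.
apply/idP/idP; last exact: strand_transfer.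
by move/(strand_transfer along_i); rewrite eq_ir strand_sym eq_ir strand_sym.
Qed.

(** * Correspondence of strands, edges and circles *)

(** A preimage under [r] rather than an image under [i], because a strand of [F'] may also have
    darts at nodes that subdivide it, outside the image of [i]. *)
Definition thicken (X : {set dart F}) : {set dart F'} := r @^-1: X.

Lemma strand_thicken u : strand u = thicken (strand (r u)).
Proof. by apply/setP=> v; rewrite [RHS]inE strand_r. Qed.

Lemma thicken_inj : injective thicken.
Proof.
by move=> X Y /setP eqXY; apply/setP=> x; have := eqXY (i x); rewrite !inE rK.
Qed.

Lemma strand_i_thicken x : strand (i x) = thicken (strand x).
Proof. by rewrite strand_thicken rK. Qed.

Lemma strands_thicken : strands F' = [set thicken X | X in strands F].
Proof.
apply/setP=> X; apply/imsetP/imsetP=> [[u _ ->]|[_ /imsetP[x _ ->] ->]].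
  by exists (strand (r u)); rewrite ?strand_thicken ?imset_f.
by exists (i x); rewrite // strand_i_thicken.
Qed.

Lemma has_vertex_thicken (X : {set dart F}) :
  [exists u in thicken X, is_vertex u] = [exists x in X, is_vertex x].
Proof.
apply/exists_inP/exists_inP=> [[u]|[x]]; rewrite ?inE => xX vx.
  by exists (r u); rewrite // -vertex_i vertex_ir.
by exists (i x); rewrite ?inE ?rK ?vertex_i.
Qed.

Lemma edges_thicken : edges F' = [set thicken X | X in edges F].
Proof.
apply/setP=> X; rewrite inE strands_thicken; apply/andP/imsetP => [|[Y]].
  by case=> /imsetP[Y sY ->]; rewrite has_vertex_thicken; exists Y; rewrite ?inE ?sY.
by rewrite inE => /andP[sY vY] ->; rewrite has_vertex_thicken imset_f.
Qed.

Lemma circles_thicken : circles F' = [set thicken X | X in circles F].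
Proof.
apply/setP=> X; rewrite inE strands_thicken edges_thicken; apply/andP/imsetP => [|[Y]].
  case=> nX /imsetP[Y sY XE]; exists Y; rewrite // inE sY andbT.
  by apply: contra nX => eY; rewrite XE imset_f.
by rewrite inE => /andP[nY sY] ->; rewrite (mem_imset _ _ thicken_inj) nY imset_f.
Qed.

(** A circle component meets no vertex, so the correction term of [odd_bars] counts an empty set. *)
Lemma odd_bars_circle X : X \in circles F ->
  odd (bars (thicken X)) = odd (bars X).
Proof.
rewrite inE => /andP[nX sX]; have : ~~ [exists x in X, is_vertex x].
  by apply: contra nX => vX; rewrite inE sX.
case/imsetP: sX => x _ -> /exists_inPn vX.
rewrite -strand_i_thicken odd_bars rK (_ : [set _ in _ | _] = set0) ?cards0 ?addbF //.
by apply/setP=> y; rewrite inE in_set0; apply/negP=> /and3P[/vX/negP].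
Qed.

Lemma card_circles_thicken (b : bool) :
  #|[set X in circles F' | odd (bars X) == b]| =
  #|[set X in circles F | odd (bars X) == b]|.
Proof.
rewrite -(card_imset _ thicken_inj) circles_thicken; apply: eq_card => X.
apply/setIdP/imsetP=> [[/imsetP[Y cY ->]]|[Y /setIdP[cY pY] ->]].
  by rewrite odd_bars_circle // => pY; exists Y; rewrite // inE cY.
by rewrite odd_bars_circle // imset_f.
Qed.

(** By [strand_vertexP] the only darts of the edge at vertices are [x] and [y], so the correction
    term of [odd_bars] has the parity of the number of its ends on turned disks. *)
Lemma half_twisted_i x y : is_vertex x -> is_vertex y -> x != y ->
  y \in strand x -> half_twisted (i x) = half_twisted x (+) (d x (+) d y).
Proof.
move=> vx vy nxy xy; rewrite /half_twisted odd_bars rK; congr (_ (+) _).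
rewrite (_ : [set z in _ | _] = [set z | (z \in [set x; y]) && d z]); last first.
  apply/setP=> z; apply/setIdP/setIdP=> [[xz /andP[vz ->]]|[]]; last first.
    by case/set2P=> -> ->; rewrite ?vx ?vy ?strand_refl.
  split=> //; apply/set2P; have [->|nzx] := eqVneq z x; [by left|right].
  by rewrite (strand_vertexP vx vz vy _ _ nzx) // 1?eq_sym.
rewrite -sum1dep_card big_mkcondr big_setU1 ?inE //= big_set1.
by case: (d x); case: (d y).
Qed.

(** Turning a disk over exchanges successor and predecessor. If only [y] is at a vertex, both sides
    are false, because [turn] preserves being at a vertex. *)
Lemma turn_iE x y : is_vertex x || is_vertex y ->
  (i y == turn (i x)) = (if d x then x == turn y else y == turn x).
Proof.
have [vx _|nvx /= vy] := boolP (is_vertex x).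
  rewrite turn_i // (inj_eq iI); case: (d x) => //.
  by rewrite -(inj_eq (@turn_inj F)) (f_finv (@turn_inj F)) eq_sym.
transitivity false; first by apply: contraNF nvx => /eqP/(congr1 (@is_vertex F'));
  rewrite is_vertex_turn !vertex_i vy.
by apply/esym; case: (d x); apply: contraNF nvx => /eqP yx; move: vy;
  rewrite yx is_vertex_turn.
Qed.

Lemma d_turn_eq x y : (y == turn x) ==> (d y == d x).
Proof. by apply/implyP=> /eqP ->; rewrite d_turn. Qed.

Definition thickens (A : {set {set dart F}}) := [set thicken X | X in A].

Lemma strand_thickens A x : (strand (i x) \in thickens A) = (strand x \in A).
Proof. by rewrite strand_i_thicken (mem_imset _ _ thicken_inj). Qed.

Lemma band_thickens A x y : band (thickens A) (i x) (i y) = band A x y.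
Proof. by rewrite /band /= !vertex_i (inj_eq iI) strand_thickens strand_i. Qed.

(** Neighbouring darts lie on the same disk and have the same [d]; if it is turned over, the two
    alternatives are merely swapped. *)
Lemma turn_sym_i x y : is_vertex x || is_vertex y ->
  (i y == turn (i x)) || (i x == turn (i y)) = (y == turn x) || (x == turn y).
Proof.
move=> vxy; rewrite !turn_iE //; last by rewrite orbC.
move: (d_turn_eq x y) (d_turn_eq y x).
by case: (y == _); case: (x == _); case: (d x); case: (d y).
Qed.

(** * Invariants of the surfaces of corresponding spanning subdiagrams *)

Lemma n_comp_surf_rel A :
  n_comp (surf_rel (thickens A)) (@is_vertex F') = n_comp (surf_rel A) (@is_vertex F).
Proof.
apply: n_comp_inj iI _ _ _ _ => [||u v|u vu||x y vx].
- exact: surf_rel_sym.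
- exact: surf_rel_sym.
- by case/or3P=> [/eqP->|/eqP->|/and5P[]] //; rewrite is_vertex_turn.
- by apply/codomP; exists (r u); rewrite vertex_ir.
- by [].
by rewrite /surf_rel /= band_thickens !orbA turn_sym_i // vx.
Qed.

Lemma surf_comp_thickens A : surf_comp (thickens A) = surf_comp A.
Proof. by rewrite /surf_comp isolatedE n_comp_surf_rel. Qed.

Lemma num_vertices_thickens : num_vertices F' = num_vertices F.
Proof.
rewrite /num_vertices isolatedE !fcard_turn -n_comp_surf_rel.
by rewrite /thickens imset0.
Qed.

Lemma surf_betti_thickens A : surf_betti (thickens A) = surf_betti A.
Proof.
by rewrite /surf_betti surf_comp_thickens num_vertices_thickens
  (card_imset _ thicken_inj).
Qed.

(** On a disk that is turned over, the boundary points just before and just after a dart change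
    places. *)
Let hat (p : dart F * bool) := (i p.1, p.2 (+) d p.1).

Lemma surf_boundary_thickens A : surf_boundary (thickens A) = surf_boundary A.
Proof.
rewrite /surf_boundary isolatedE; congr (_ + _).
apply: (n_comp_inj (h := hat)) => 
  [p q|p q|[x b] [y c] /= []|p q|[u b] /= vu|[x b] /=|[x b] [y c] /= vx].
- exact: orbC.
- exact: orbC.
- by move=> /iI -> /addIb ->.
- have turn_vertex u v : v == turn u -> is_vertex u = is_vertex v.
    by move=> /eqP ->; rewrite is_vertex_turn.
  have step_vertex p' q' : boundary_step (thickens A) p' q' ->
      is_vertex p'.1 = is_vertex q'.1.
    case/or3P=> [/and3P[_ _ /turn_vertex //]|/andP[/and5P[-> ->]] //|].
    by case/and3P=> _ /eqP ->.
  by case/orP=> /step_vertex /= ->.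
- apply/codomP; exists (r u, b (+) d (r u)).
  by rewrite /hat /= vertex_ir // -addbA addbb addbF.
- exact: vertex_i.
rewrite /boundary_step /= !(inj_eq iI) !strand_thickens !band_thickens.
rewrite !turn_iE ?vx ?orbT // (band_sym A y x).
move: (d_turn_eq x y) (d_turn_eq y x).
have [bxy|_] := boolP (band A x y); rewrite ?andbF ?andFb.
  have /and5P[_ vy nxy _ xy] := bxy.
  (* Along a band the flags change by [d x] and [d y] at the two ends; the extra half twists change
     the matching of the sides by the same amount. *)
  have xE : half_twisted (i x) = half_twisted x (+) (d x (+) d y).
    exact: half_twisted_i.
  have yE : half_twisted (i y) = half_twisted x (+) (d x (+) d y).
    by rewrite -xE /half_twisted; congr (odd (bars _));
      apply/esym/eqP; rewrite eq_strand strand_i.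
  have -> : half_twisted y = half_twisted x.
    by rewrite /half_twisted; congr (odd (bars _)); apply/esym/eqP; rewrite eq_strand.
  rewrite xE yE (eq_sym y x) (negbTE nxy) !andbF.
  case: (half_twisted x); case: (y == _); case: (x == _); case: (d x); case: (d y);
    by case: b; case: c.
(* Without a band there remain the steps along a disk. Those on a turned disk run backwards, which
   the symmetrised relation absorbs; [y = x] covers the place of a band left out and also the disk
   boundary at a vertex of degree one. *)
have [->|nxy] := eqVneq y x; rewrite ?andbF.
  case: (_ == _); case: (_ \in _); case: (d x); by case: b; case: c.
by case: (y == turn x); case: (x == turn y); case: (d x); case: (d y); case: b; case: c.
Qed.

(** Reversing the orientation exactly on the turned disks changes the condition at a band by
    [d x (+) d y], which is the change in its half twists. *)
Lemma surf_orientable_thickens A : surf_orientable (thickens A) = surf_orientable A.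
Proof.
apply/existsP/existsP=> -[o /andP[/forallP oturn /forallP oband]].
  exists [ffun x => o (i x) (+) d x]; apply/andP; split; apply/forallP=> x.
    apply/implyP=> vx; rewrite !ffunE d_turn; apply/eqP; congr (_ (+) _).
    have o_i y : is_vertex y -> o (turn (i y)) = o (i y).
      by rewrite -vertex_i => vy; apply/eqP; apply: implyP (oturn _) vy.
    (* On a turned disk [turn (i (turn x))] is [i x], so there the equality is read at [turn x]
       instead of [x]. *)
    have := o_i x vx; have := o_i (turn x); rewrite is_vertex_turn vx !turn_i ?is_vertex_turn //.
    by rewrite d_turn (finv_f (@turn_inj F)); case: (d x) => // ->.
  apply/forallP=> y; apply/implyP=> bxy; have /and5P[vx vy nxy _ xy] := bxy.
  have /forallP/(_ (i y))/implyP := oband (i x); rewrite band_thickens => /(_ bxy).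
  rewrite !ffunE (half_twisted_i vx vy nxy xy) => /eqP oE; rewrite addbACA oE.
  by case: (half_twisted x); case: (d x); case: (d y).
exists [ffun u => o (r u) (+) d (r u)]; apply/andP; split; apply/forallP=> u.
  apply/implyP=> vu; have vx : is_vertex (r u) by rewrite -vertex_i vertex_ir.
  rewrite -(vertex_ir vu); move: (r u) vx => x vx; rewrite !ffunE turn_i // !rK.
  have := implyP (oturn x) vx; have := oturn (finv turn x).
  rewrite is_vertex_finv vx /= (f_finv (@turn_inj F)) => /eqP oE /eqP oE'.
  by case dx: (d x); rewrite /= ?d_turn ?d_finv dx -?oE ?oE' eqxx.
apply/forallP=> v; apply/implyP=> buv; have /and5P[vu vv _ _ _] := buv.
rewrite -(vertex_ir vu) -(vertex_ir vv) in buv *; rewrite band_thickens in buv.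
rewrite !ffunE !rK; move: (r u) (r v) buv => x y bxy; have /and5P[vx vy nxy _ xy] := bxy.
have /forallP/(_ y)/implyP/(_ bxy)/eqP oE := oband x.
by rewrite (half_twisted_i vx vy nxy xy) addbACA oE.
Qed.

Lemma Q_turning_disks (K : comNzRingType) (y z w : K) : Q F' y z w = Q F y z w.
Proof.
have evenE : even_circles F' = even_circles F.
  have E G : even_circles G = #|[set X in circles G | odd (bars X) == false]|.
    by apply: eq_card => X; rewrite !inE eqbF_neg.
  by rewrite !E card_circles_thicken.
have oddE : odd_circles F' = odd_circles F.
  have E G : odd_circles G = #|[set X in circles G | odd (bars X) == true]|.
    by apply: eq_card => X; rewrite !inE eqb_id.
  by rewrite !E card_circles_thicken.
rewrite /Q evenE oddE; congr (_ * _)%R.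
(* Every set of edges of [F'] is thickened from exactly one set of edges of [F], so the sum over
   spanning subdiagrams can be reindexed. *)
have edgesE : [set A : {set {set dart F'}} | A \subset edges F'] =
    thickens @: [set A : {set {set dart F}} | A \subset edges F].
  apply/setP=> A; rewrite inE; apply/idP/imsetP=> [sA|[B]]; last first.
    by rewrite inE => sB ->; rewrite edges_thicken imsetS.
  exists (edges F :&: [set X | thicken X \in A]); first by rewrite inE subsetIl.
  apply/setP=> X; apply/idP/imsetP => [XA|[Y]]; last by rewrite !inE => /andP[_ YA] ->.
  have := subsetP sA X XA; rewrite edges_thicken => /imsetP[Y eY XE].
  by exists Y; rewrite // inE eY inE -XE.
rewrite -[LHS]big_set -[RHS]big_set edgesE big_imset /=; last first.
  exact: in2W (imset_inj thicken_inj).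
apply: eq_bigr => A _; rewrite /M /surf_t.
by rewrite surf_comp_thickens surf_betti_thickens surf_boundary_thickens
  surf_orientable_thickens.
Qed.

End TurningDisks.

(** * Spins, and the symmetries of the corners of a crossing *)

Lemma spin_at_nonclassical (E : diagram) (s : state E) x :
  ~~ is_classical x -> spin_at s x = None.
Proof.
by move=> ncx; case sx: (spin_at s x) => //; case/negP: ncx;
  apply: (@is_classical_spin E s); rewrite sx.
Qed.

Lemma spin_at_classical (E : diagram) (s : state E) (x : dart E) :
  is_classical x -> spin_at s x.
Proof.
move=> cx; rewrite /spin_at; case: insubP => //=.
by rewrite (imset_f (@node_of E) (cx : x \in @is_classical E)).
Qed.

Definition prev_corner (c : corner) : corner :=
  match c with NE => SE | NW => NE | SW => NW | SE => SW end.
(** Reflection in the horizontal axis, in two roles: it pairs the ends joined at spin 1, and it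
    relates each old end to the dart of the new crossing on its strand. The pairing at spin -1 is
    [flop]. *)
Definition mirror (c : corner) : corner :=
  match c with NE => SE | SE => NE | NW => SW | SW => NW end.
Definition flop (c : corner) : corner :=
  match c with NE => NW | NW => NE | SW => SE | SE => SW end.

(* The end of the old crossing to which the dart [c] of the piece [p] is joined
   without passing through the new classical crossing. *)
Definition home (p : piece) (c : corner) : corner :=
  match p, c with
  | Bars, _ => c
  | LeftVirtual, (NW | SE) => NW
  | LeftVirtual, (SW | NE) => SW
  | RightVirtual, (NE | SW) => NE
  | RightVirtual, (SE | NW) => SE
  | Crossing, _ => mirror c
  end.

Definition spin_turn (o : option spin) (c : corner) : corner :=
  match o with
  | Some Plus => mirror c
  | Some Minus => flop c
  | Some Zero | None => next_corner c
  end.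

Lemma mirrorK : involutive mirror. Proof. by case. Qed.

(** The pairings at spin 1 and -1 are reflections in perpendicular axes, which commute; hence the
    smoothed new crossing joins the same outer ends as the old one. At spin 0 [mirror] instead
    reverses the cyclic order. *)
Lemma mirror_spin_turn (o : option spin) c : o -> o != Some Zero ->
  mirror (spin_turn o c) = spin_turn o (mirror c).
Proof. by case: o => [[]|] // _ _; case: c. Qed.

(** * The darts of the two diagrams of the move *)

Section MoveT3.

Variables (E E' : diagram) (x0 : dart E).
Variables (phi : dart E + piece * corner -> dart E').
Variable psi : dart E' -> dart E + piece * corner.

Let old u := phi (inl u).
Let new p c := phi (inr (p, c)).
Let end_ c := corner_dart x0 c.
Let near u := fconnect turn x0 u.

Implicit Types (u y : dart E) (v w : dart E').

Hypothesis kind_x0 : kind x0 = Over.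
Hypotheses (phiK : cancel phi psi) (psiK : cancel psi phi).
Hypothesis isolatedE : isolated E' = isolated E.
Hypothesis flip_old : forall u, flip (old u) = old (flip u).
Hypothesis off_old : forall u, ~~ near u ->
  turn (old u) = old (turn u) /\ kind (old u) = kind u.
Hypothesis bar_old : forall c, [/\ turn (old (end_ c)) = new Bars c,
  turn (new Bars c) = old (end_ c) & kind (old (end_ c)) = Bar].
Hypothesis turn_new : forall p c, p <> Bars -> turn (new p c) = new p (next_corner c).
Hypothesis kind_flip_new : forall p c,
  kind (new p c) = piece_kind p c /\ flip (new p c) = phi (inr (piece_flip p c)).

Lemma order_x0 : order turn x0 = 4.
Proof. by have := kind_degree x0; rewrite kind_x0 => /eqP. Qed.

Lemma orbit_x0 : orbit turn x0 = [:: end_ NE; end_ NW; end_ SW; end_ SE].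
Proof. by rewrite /orbit order_x0. Qed.

Lemma turn_end c : turn (end_ c) = end_ (next_corner c).
Proof.
case: c => //; rewrite /end_ /=; have := iter_order (@turn_inj E) x0.
by rewrite order_x0.
Qed.

(** Inverse of [end_] on the crossing of the move; away from it, the value [NE] is a default. *)
Definition corner_of u : corner :=
  if u == end_ NW then NW else if u == end_ SW then SW
  else if u == end_ SE then SE else NE.

Lemma end_K : cancel end_ corner_of.
Proof.
have := orbit_uniq turn x0; rewrite orbit_x0 /= !inE !negb_or.
case/and4P=> /and3P[n1 n2 n3] /andP[n4 n5] n6 _.
case; rewrite /corner_of ?eqxx ?(negbTE n1) ?(negbTE n2) ?(negbTE n3) //.
- by rewrite eq_sym (negbTE n4).
by rewrite ![end_ SE == _]eq_sym (negbTE n5) (negbTE n6).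
Qed.

Lemma near_end c : near (end_ c).
Proof. by rewrite /near fconnect_orbit orbit_x0 !inE; case: c; rewrite eqxx ?orbT. Qed.

Lemma corner_ofK u : near u -> end_ (corner_of u) = u.
Proof.
rewrite /near fconnect_orbit orbit_x0 !inE.
by case/or4P=> /eqP->; rewrite end_K.
Qed.

Lemma near_turn u : near (turn u) = near u.
Proof. by rewrite /near -same_fconnect1_r //; apply: turn_inj. Qed.

Lemma near_finv u : near (finv turn u) = near u.
Proof. by rewrite -near_turn (f_finv (@turn_inj E)). Qed.

Lemma finv_end c : finv turn (end_ c) = end_ (prev_corner c).
Proof.
by apply: (@turn_inj E); rewrite (f_finv (@turn_inj E)) turn_end; case: c.
Qed.

Lemma kind_end c : kind (end_ c) = piece_kind Crossing c.
Proof. by case: c; rewrite /end_ /= ?kind_turn kind_x0. Qed.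

Lemma classical_end c : is_classical (end_ c).
Proof. by rewrite /is_classical kind_end; case: c. Qed.

Variant new_dart_spec : dart E' -> Prop :=
  | OffDart u of ~~ near u : new_dart_spec (old u)
  | EndDart c : new_dart_spec (old (end_ c))
  | PieceDart p c : new_dart_spec (new p c).

Lemma new_dartP v : new_dart_spec v.
Proof.
rewrite -(psiK v); case: (psi v) => [u|[p c]]; last exact: PieceDart.
have [nu|] := boolP (near u); last exact: OffDart.
by rewrite -(corner_ofK nu); apply: EndDart.
Qed.

Lemma finv_new c : finv turn (new Crossing c) = new Crossing (prev_corner c).
Proof.
by apply: (@turn_inj E'); rewrite (f_finv (@turn_inj E')) turn_new //; case: c.
Qed.

Lemma finv_old u : ~~ near u -> finv turn (old u) = old (finv turn u).
Proof.
move=> nu; apply: (@turn_inj E'); rewrite (f_finv (@turn_inj E')).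
by have [|->] := off_old (u := finv turn u); rewrite ?near_finv ?(f_finv (@turn_inj E)).
Qed.

Lemma classical_new c : is_classical (new Crossing c).
Proof. by rewrite /is_classical !(kind_flip_new _ _).1; case: c. Qed.

(* [emb] sends an end of the old crossing to the dart of the new crossing on the
   same strand, whatever the spin. *)
Definition emb u : dart E' :=
  if near u then new Crossing (mirror (corner_of u)) else old u.
Definition ret v : dart E :=
  match psi v with inl u => u | inr (p, c) => end_ (home p c) end.

Lemma emb_end c : emb (end_ c) = new Crossing (mirror c).
Proof. by rewrite /emb near_end end_K. Qed.

Lemma emb_off u : ~~ near u -> emb u = old u.
Proof. by rewrite /emb => /negbTE->. Qed.

Lemma ret_old u : ret (old u) = u. Proof. by rewrite /ret phiK. Qed.

Lemma ret_new p c : ret (new p c) = end_ (home p c).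
Proof. by rewrite /ret phiK. Qed.

Lemma embK : cancel emb ret.
Proof.
move=> u; have [nu|nu] := boolP (near u); last by rewrite emb_off // ret_old.
by rewrite -(corner_ofK nu) emb_end ret_new /= mirrorK.
Qed.

(** At the crossing of the move the cyclic order is reversed, because [mirror] reverses that of the
    corners. *)
Lemma turn_emb u : turn (emb u) = emb (if near u then finv turn u else turn u).
Proof.
have [nu|nu] := boolP (near u).
  by rewrite -(corner_ofK nu) finv_end !emb_end turn_new //; case: (corner_of u).
by rewrite !emb_off ?near_turn //; case: (off_old nu).
Qed.

Lemma kind_emb u : ~~ near u -> kind (emb u) = kind u.
Proof. by move=> nu; rewrite emb_off //; case: (off_old nu). Qed.

(** At the crossing of the move [emb] exchanges over and under, as [mirror] does with the two
    diagonals; only being classical is kept. *)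
Lemma classical_emb u : is_classical (emb u) = is_classical u.
Proof.
have [nu|nu] := boolP (near u); last by rewrite /is_classical kind_emb.
by rewrite -(corner_ofK nu) emb_end classical_new classical_end.
Qed.

Lemma classical_embP v : is_classical v -> exists2 u, is_classical u & v = emb u.
Proof.
case: (new_dartP v) => [u nu|c|p c].
- by exists u; rewrite -?classical_emb emb_off.
- by rewrite /is_classical; case: (bar_old c) => _ _ ->.
case: p => [||_|]; try by rewrite /is_classical !(kind_flip_new _ _).1; case: c.
by exists (end_ (mirror c)); rewrite ?classical_end ?emb_end ?mirrorK.
Qed.

(** * Correspondence of crossings and states *)

(** At each node [emb] preserves or reverses [turn], and the orbits are the same in either case. *)
Lemma node_emb u : node_of (emb u) = emb @: node_of u.
Proof.
have fc y z : fconnect turn y z -> fconnect turn (emb y) (emb z).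
  move=> /iter_findex <-; elim: (findex _ y z) => [|n IHn]; first exact: connect0.
  apply: connect_trans IHn _ => /=; move: (iter n turn y) => {}y.
  have := turn_emb (turn y); have := turn_emb y; rewrite near_turn.
  case: (near y) => [_|<-]; last by rewrite fconnect1.
  rewrite (finv_f (@turn_inj E)) => <-.
  by rewrite fconnect_sym ?fconnect1 //; apply: turn_inj.
apply/setP=> v; rewrite inE; apply/idP/imsetP => [|[y]]; last first.
  by rewrite inE => uy ->; apply: fc.
move=> /iter_findex <-; elim: (findex _ _ v) => [|n [y uy yE]] /=.
  by exists u; rewrite // inE connect0.
rewrite yE turn_emb; exists (if near y then finv turn y else turn y); rewrite // inE.
rewrite inE in uy; apply: connect_trans uy _; case: ifP => _; last exact: fconnect1.
exact: fconnect_finv.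
Qed.

Lemma preim_emb (X : {set dart E}) : emb @^-1: (emb @: X) = X.
Proof. by apply/setP=> y; rewrite inE mem_imset //; apply: can_inj embK. Qed.

Lemma emb_crossing (c : crossing E) : emb @: val c \in crossings E'.
Proof.
have /imsetP[u cu ->] := valP c; rewrite -node_emb.
exact: imset_f (etrans (classical_emb u) cu).
Qed.

Lemma preim_emb_crossing (c : crossing E') : emb @^-1: val c \in crossings E.
Proof.
have /imsetP[v /classical_embP[u cu ->] ->] := valP c.
by rewrite node_emb preim_emb imset_f.
Qed.

Definition new_crossing (c : crossing E) : crossing E' :=
  exist (fun X => X \in crossings E') _ (emb_crossing c).
Definition old_crossing (c : crossing E') : crossing E :=
  exist (fun X => X \in crossings E) _ (preim_emb_crossing c).

Lemma new_crossingK : cancel new_crossing old_crossing.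
Proof. by move=> c; apply: val_inj; apply: preim_emb. Qed.

Lemma old_crossingK : cancel old_crossing new_crossing.
Proof.
move=> c; apply: val_inj => /=; have /imsetP[v /classical_embP[u cu ->] ->] := valP c.
by rewrite node_emb preim_emb.
Qed.

Definition new_state (s : state E) : state E' := [ffun c => s (old_crossing c)].
Definition old_state (s : state E') : state E := [ffun c => s (new_crossing c)].

Lemma new_state_bij : bijective new_state.
Proof.
by exists old_state => s; apply/ffunP=> c; rewrite !ffunE ?new_crossingK ?old_crossingK.
Qed.

Lemma card_new_state (s : state E) t :
  #|[set c | new_state s c == t]| = #|[set c | s c == t]|.
Proof.
rewrite -[RHS](card_imset _ (can_inj new_crossingK)); apply: eq_card => c.
apply/idP/imsetP => [|[c' + ->]]; rewrite !inE !ffunE.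
  by move=> sc; exists (old_crossing c); rewrite ?inE // old_crossingK.
by rewrite new_crossingK.
Qed.

Lemma spin_at_emb (s : state E) u : spin_at (new_state s) (emb u) = spin_at s u.
Proof.
have [cu|ncu] := boolP (is_classical u); last first.
  by rewrite !spin_at_nonclassical // classical_emb.
have ceu : emb u \in @is_classical E' := etrans (classical_emb u) cu.
rewrite /spin_at; case: insubP => [c' _ c'E|]; last by rewrite (imset_f (@node_of E') ceu).
case: insubP => [c _ cE|]; last first.
  by rewrite (imset_f (@node_of E) (cu : u \in @is_classical E)).
congr Some; rewrite ffunE; congr (s _); rewrite -[RHS]new_crossingK; congr old_crossing.
by apply: val_inj; rewrite /= [LHS]c'E [val c]cE node_emb.
Qed.

(** * Comparison of two corresponding states *)

Section OneState.

Variable s : state E.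
Let s' := new_state s.
Let F := state_diagram s.
Let F' := state_diagram s'.
Let spin0 := spin_at s x0.

Lemma spin_end c : spin_at s (end_ c) = spin0.
Proof. by apply/esym/spin_at_connect; apply: near_end. Qed.

Lemma spin0_some : spin0.
Proof. exact: (spin_at_classical _ (classical_end NE)). Qed.

Lemma spin_new c : spin_at s' (new Crossing c) = spin0.
Proof. by rewrite -(mirrorK c) -emb_end spin_at_emb spin_end. Qed.

Lemma spin_old u : ~~ near u -> spin_at s' (old u) = spin_at s u.
Proof. by move=> nu; rewrite -emb_off // spin_at_emb. Qed.

Lemma spin_bar_old c : spin_at s' (old (end_ c)) = None.
Proof.
by apply: spin_at_nonclassical; rewrite /is_classical; case: (bar_old c) => _ _ ->.
Qed.

Lemma spin_piece p c : p <> Crossing -> spin_at s' (new p c) = None.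
Proof.
move=> np; apply: spin_at_nonclassical; rewrite /is_classical (kind_flip_new _ _).1.
by case: p np.
Qed.

(** Both the old and the new crossing have their over-strand from the local SW to the local NE, so
    [spin_turn] describes the state at either of them. *)
Lemma state_turn_end c : @turn F (end_ c) = end_ (spin_turn spin0 c).
Proof.
rewrite /= /state_turn spin_end kind_end finv_end turn_end.
by case: spin0 => [[]|]; case: c.
Qed.

Lemma state_turn_new c : @turn F' (new Crossing c) = new Crossing (spin_turn spin0 c).
Proof.
rewrite /= /state_turn spin_new (kind_flip_new _ _).1 finv_new turn_new //.
by case: spin0 => [[]|]; case: c.
Qed.

Lemma state_turn_piece p c : p <> Crossing -> @turn F' (new p c) = turn (new p c).
Proof. by move=> np; rewrite /= /state_turn spin_piece. Qed.

Lemma state_kind_piece p c : p <> Crossing -> @kind F' (new p c) = piece_kind p c.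
Proof. by move=> np; rewrite /= /state_kind spin_piece // (kind_flip_new _ _).1. Qed.

Lemma state_turn_bar c : @turn F' (old (end_ c)) = new Bars c.
Proof. by rewrite /= /state_turn spin_bar_old; case: (bar_old c). Qed.

Lemma state_kind_bar c : @kind F' (old (end_ c)) = Bar.
Proof. by rewrite /= /state_kind spin_bar_old; case: (bar_old c). Qed.

Lemma near_state_turn u : near (@turn F u) = near u.
Proof.
by rewrite /= /state_turn; case: (spin_at s u) => [[]|]; do ?case: ifP => _;
  rewrite ?near_finv ?near_turn.
Qed.

Lemma state_turn_old u : ~~ near u -> @turn F' (old u) = old (@turn F u).
Proof.
move=> nu; have [tu ku] := off_old nu.
rewrite /= /state_turn spin_old // finv_old // tu ku.
by case: (spin_at s u) => [[]|]; do ?case: ifP.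
Qed.

Lemma state_kind_old u : ~~ near u -> @kind F' (old u) = @kind F u.
Proof.
by move=> nu; have [tu ku] := off_old nu; rewrite /= /state_kind spin_old // ku.
Qed.

Lemma across_old u : ~~ near u -> @across F' (old u) = old (@across F u).
Proof.
move=> nu; have nt : ~~ near (@turn F u) by rewrite near_state_turn.
rewrite /across state_kind_old // (state_turn_old nu) (state_turn_old nt).
by case: (kind _).
Qed.

Lemma state_kind_end c :
  @kind F (end_ c) = if spin0 is Some Zero then Vertex else Joint.
Proof. by rewrite /= /state_kind spin_end; move: spin0_some; case: spin0 => [[]|]. Qed.

Lemma state_kind_new c :
  @kind F' (new Crossing c) = if spin0 is Some Zero then Vertex else Joint.
Proof. by rewrite /= /state_kind spin_new; move: spin0_some; case: spin0 => [[]|]. Qed.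

Lemma vertex_end c : @is_vertex F (end_ c) = (spin0 == Some Zero).
Proof. by rewrite /is_vertex state_kind_end; case: spin0 => [[]|]. Qed.

Lemma vertex_new c : @is_vertex F' (new Crossing c) = (spin0 == Some Zero).
Proof. by rewrite /is_vertex state_kind_new; case: spin0 => [[]|]. Qed.

Lemma across_end c : spin0 != Some Zero ->
  @across F (end_ c) = end_ (spin_turn spin0 c).
Proof.
by move=> sp; rewrite /across state_kind_end state_turn_end; case: spin0 sp => [[]|].
Qed.

Lemma across_new c : spin0 != Some Zero ->
  @across F' (new Crossing c) = new Crossing (spin_turn spin0 c).
Proof.
by move=> sp; rewrite /across state_kind_new state_turn_new; case: spin0 sp => [[]|].
Qed.

Lemma across_bar_old c : @across F' (old (end_ c)) = new Bars c.
Proof. by rewrite /across state_kind_bar state_turn_bar. Qed.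

Lemma across_virtual p c : p = LeftVirtual \/ p = RightVirtual ->
  @across F' (new p c) = new p (next_corner (next_corner c)).
Proof.
move=> pV; have np : p <> Crossing by case: pV => ->.
have nb : p <> Bars by case: pV => ->.
rewrite /across state_kind_piece // (_ : piece_kind p c = Virtual); last first.
  by case: pV => ->; case: c.
by rewrite !(state_turn_piece, turn_new).
Qed.

(** Each dart of a piece is followed outwards, through a virtual crossing if necessary, to the bar
    where its strand leaves the disk of the move. *)
Lemma strand_new p c : @strand F' (new p c) = @strand F' (old (end_ (home p c))).
Proof.
have fl q e : @strand F' (phi (inr (piece_flip q e))) = @strand F' (new q e).
  by rewrite -(kind_flip_new q e).2 (@strand_flip F').
have bar e : @strand F' (new Bars e) = @strand F' (old (end_ e)).
  by rewrite -across_bar_old strand_across.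
have lv e : @strand F' (new LeftVirtual (next_corner (next_corner e)))
    = @strand F' (new LeftVirtual e).
  by rewrite -across_virtual ?strand_across //; left.
have rv e : @strand F' (new RightVirtual (next_corner (next_corner e)))
    = @strand F' (new RightVirtual e).
  by rewrite -across_virtual ?strand_across //; right.
(* The equalities spread inwards: from the bars to the outer ends of the virtual crossings, straight
   through these, then to the classical crossing. *)
have lvNW := fl Bars NW; have lvSW := fl Bars SW.
have rvNE := fl Bars NE; have rvSE := fl Bars SE.
rewrite /= -!/(new _ _) !bar in lvNW lvSW rvNE rvSE.
have lvSE := lv NW; have lvNE := lv SW; have rvSW := rv NE; have rvNW := rv SE.
rewrite /= lvNW lvSW rvNE rvSE in lvSE lvNE rvSW rvNW.
have cNW := fl LeftVirtual NE; have cSW := fl LeftVirtual SE.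
have cNE := fl RightVirtual NW; have cSE := fl RightVirtual SW.
rewrite /= -!/(new _ _) lvNE lvSE rvNW rvSW in cNW cSW cNE cSE.
by case: p; case: c.
Qed.

Lemma strand_emb y : @strand F' (emb y) = @strand F' (old y).
Proof.
have [ny|ny] := boolP (near y); last by rewrite emb_off.
by rewrite -(corner_ofK ny) emb_end strand_new /= mirrorK.
Qed.

Lemma emb_ret_strand v : emb (ret v) \in @strand F' v.
Proof.
rewrite -(@eq_strand F') strand_emb; case: (new_dartP v) => [u _|c|p c]; rewrite ?ret_old //.
by rewrite ret_new strand_new.
Qed.

Lemma ret_along v w : @along F' v w -> ret w \in @strand F (ret v).
Proof.
case/orP=> [/eqP->|/andP[nv /eqP->]]; rewrite -(@eq_strand F); apply/eqP.
  case: (new_dartP v) => [u _|c|p c]; rewrite /= ?flip_old ?ret_old ?(@strand_flip F) //.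
  rewrite (kind_flip_new p c).2 /ret !phiK.
  (* The two ends of an arc inside the disk of the move have the same [home]. *)
  by case: p; case: c.
case: (new_dartP v) nv => [u nu|c|p c].
- by rewrite across_old // !ret_old strand_across.
- by rewrite across_bar_old ret_old ret_new.
case: p => [_|_|nv|_].
- by rewrite ret_new -across_bar_old acrossK ret_old.
- by rewrite across_virtual ?ret_new; [case: c | left].
(* Only here does the spin matter: it is 1 or -1, and the smoothing commutes with [mirror]. *)
- rewrite vertex_new in nv; rewrite across_new // !ret_new /=.
  by rewrite mirror_spin_turn ?spin0_some // -across_end // strand_across.
- by rewrite across_virtual ?ret_new; [case: c | right].
Qed.

Lemma emb_along u y : @along F u y -> emb y \in @strand F' (emb u).
Proof.
case/orP=> [/eqP->|/andP[nv /eqP->]]; rewrite -(@eq_strand F'); apply/eqP.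
  by rewrite !strand_emb -flip_old (@strand_flip F').
have [nu|nu] := boolP (near u); last first.
  by rewrite !strand_emb -across_old // strand_across.
move: nv; rewrite -(corner_ofK nu) vertex_end => nv.
rewrite across_end // !emb_end mirror_spin_turn ?spin0_some //.
by rewrite -across_new // strand_across.
Qed.

Lemma vertex_emb u : @is_vertex F' (emb u) = @is_vertex F u.
Proof.
have [nu|nu] := boolP (near u); last by rewrite emb_off // /is_vertex state_kind_old.
by rewrite -(corner_ofK nu) emb_end vertex_end vertex_new.
Qed.

Lemma vertex_emb_ret v : @is_vertex F' v -> emb (ret v) = v.
Proof.
case: (new_dartP v) => [u nu|c|p c].
- by rewrite ret_old emb_off.
- by rewrite /is_vertex state_kind_bar.
case: p => [||_|]; try by rewrite /is_vertex state_kind_piece //; case: c.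
by rewrite ret_new emb_end mirrorK.
Qed.

Definition turned u : bool := near u && (spin0 == Some Zero).

Lemma turned_turn u : turned (@turn F u) = turned u.
Proof. by rewrite /turned near_state_turn. Qed.

Lemma vertex_near u : near u -> @is_vertex F u = (spin0 == Some Zero).
Proof. by move=> nu; rewrite -(corner_ofK nu) vertex_end. Qed.

Lemma state_turn_emb u : @is_vertex F u ->
  @turn F' (emb u) = emb (if turned u then finv (@turn F) u else @turn F u).
Proof.
rewrite /turned; have [nu|nu] := boolP (near u); last first.
  by rewrite !emb_off ?near_state_turn // state_turn_old.
rewrite vertex_near // => sp; rewrite sp -(corner_ofK nu).
have -> : finv (@turn F) (end_ (corner_of u)) = end_ (prev_corner (corner_of u)).
  apply: (@turn_inj F); rewrite (f_finv (@turn_inj F)) state_turn_end.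
  by rewrite (eqP sp); case: (corner_of u).
by rewrite !emb_end state_turn_new (eqP sp); case: (corner_of u).
Qed.

(** At spin 0 the two sets agree. At spin 1 or -1 the right one is empty and the left one even,
    since the smoothing puts the four ends in pairs on common strands. *)
Lemma odd_near_strand (u : dart F) :
  odd #|[set z in strand u | near z]| =
  odd #|[set z in strand u | @is_vertex F z && turned z]|.
Proof.
rewrite /turned; have [sp|sp] := boolP (spin0 == Some Zero).
  congr (odd _); apply: eq_card => z; apply/setIdP/setIdP; last by case=> -> /and3P[].
  by case=> -> nz; rewrite vertex_near // nz sp.
rewrite [in RHS](_ : [set z in _ | _] = set0); last first.
  by apply/setP=> z; rewrite inE !andbF in_set0.
rewrite cards0; have -> : [set z in strand u | near z] =
    [set z in filter (mem (strand u)) (orbit turn x0)].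
  by apply/setP=> z; rewrite [RHS]in_set mem_filter -fconnect_orbit inE.
rewrite cardsE (card_uniqP _) ?filter_uniq ?orbit_uniq // size_filter orbit_x0 /=.
have pair c : (end_ (spin_turn spin0 c) \in strand u) = (end_ c \in strand u).
  by rewrite -across_end // -!(@eq_strand F) strand_across.
move: (pair NE) (pair NW) (pair SE) (pair SW); move: sp spin0_some.
case: spin0 => [[]|] //= _ _;
  case: (end_ NE \in strand u); case: (end_ NW \in strand u);
  by case: (end_ SW \in strand u); case: (end_ SE \in strand u).
Qed.

(** Each end of the old crossing on the strand brings one more bar; its two darts are that end
    itself and the matching inner dart of [Bars]. *)
Lemma odd_bars_state v : odd (bars (@strand F' v)) =
  odd (bars (@strand F (ret v)))
    (+) odd #|[set z in @strand F (ret v) | @is_vertex F z && turned z]|.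
Proof.
have mem w : (ret w \in @strand F (ret v)) = (w \in @strand F' v).
  exact: (@strand_r F F' emb ret emb_ret_strand ret_along emb_along).
have mem_old y : (old y \in @strand F' v) = (y \in @strand F (ret v)).
  by rewrite -mem ret_old.
rewrite -odd_near_strand /bars.
set B' : {set dart E'} := [set x in _ | _]; set B : {set dart E} := [set x in _ | _].
set N : {set dart E} := [set z in _ | near z].
pose bar y := new Bars (corner_of y).
have B'E : B' = (old @: (B :|: N)) :|: (bar @: N).
  apply/setP=> w; apply/setIdP/setUP=> [[]|].
    case: (new_dartP w) => [u nu|c|p c].
    - rewrite mem_old state_kind_old // => vu ku; left; apply: imset_f.
      by apply/setUP; left; apply/setIdP.
    - rewrite mem_old => vc _; left; apply: imset_f.
      by apply/setUP; right; apply/setIdP; split=> //; apply: near_end.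
    case: p => [vc _|||]; first last.
    - by rewrite state_kind_piece //; case: c.
    - by rewrite state_kind_new; case: (spin0) => [[]|].
    - by rewrite state_kind_piece //; case: c.
    right; apply/imsetP; exists (end_ c); last by rewrite /bar end_K.
    by apply/setIdP; split; [rewrite -mem ret_new in vc | apply: near_end].
  case=> /imsetP[y]; last first.
    move=> /setIdP[vy ny] ->; split; last by rewrite state_kind_piece.
    by rewrite -mem ret_new /= corner_ofK.
  case/setUP=> /setIdP[vy]; last first.
    by move=> ny ->; rewrite mem_old -{2}(corner_ofK ny) state_kind_bar.
  move=> ky ->; rewrite mem_old state_kind_old //.
  by apply: contraL ky => ny; rewrite -(corner_ofK ny) state_kind_end;
    case: (spin0) => [[]|].
have oldI : injective old by move=> y z /(congr1 ret); rewrite !ret_old.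
have barI : {in N &, injective bar}.
  move=> y z /setIdP[_ ny] /setIdP[_ nz] /(congr1 ret); rewrite !ret_new /=.
  by rewrite !corner_ofK.
(* In the state of [E], the ends of the crossing are at joints or at a vertex, never at a bar. *)
have BN : B :&: N = set0.
  apply/setP=> y; rewrite in_set0; apply/negP=> /setIP[/setIdP[_ ky] /setIdP[_ ny]].
  by move: ky; rewrite -(corner_ofK ny) state_kind_end; case: (spin0) => [[]|].
have old_bar : (old @: (B :|: N)) :&: (bar @: N) = set0.
  apply/setP=> w; rewrite in_set0; apply/negP=> /setIP[/imsetP[y _ ->] /imsetP[z _]].
  by move/(congr1 psi); rewrite !phiK.
(* The bar darts number [#|B|] plus twice [#|N|]; the added number being even, halving with
   truncation gives exactly [#|N|] more bars. *)
rewrite B'E cardsU old_bar cards0 subn0 (card_imset _ oldI) (card_in_imset barI).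
by rewrite cardsU BN cards0 subn0 -addnA addnn halfD odd_double
  andbF add0n doubleK oddD.
Qed.

Lemma Q_new_state (K : comNzRingType) (y z w : K) : Q F' y z w = Q F y z w.
Proof.
apply: (@Q_turning_disks F F' emb ret turned) => //.
- exact: embK.
- exact: emb_ret_strand.
- exact: ret_along.
- exact: emb_along.
- exact: vertex_emb.
- exact: vertex_emb_ret.
- exact: turned_turn.
- exact: state_turn_emb.
- exact: odd_bars_state.
Qed.

End OneState.

Lemma state_sum_T3 (K : comNzRingType) (a a' z w : K) :
  state_sum a a' z w E = state_sum a a' z w E'.
Proof.
rewrite /state_sum [RHS](reindex new_state) /=; last exact: onW_bij new_state_bij.
by apply: eq_bigr => s _; rewrite /num_plus /num_minus !card_new_state Q_new_state.
Qed.

End MoveT3.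

Theorem proposition6p13 (E E' : diagram) (planarE : planar E)
    (planarE' : planar E') (moveEE' : T3 E E') : R E = R E'.
Proof.
case: moveEE' => x0 [phi [[kx0 [psi phiK psiK] isoE] [fo oo bo tn kf]]].
exact: (state_sum_T3 kx0 phiK psiK isoE fo oo bo tn kf).
Qed.
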